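(* Let $n\ge0$ and let $\sigma,\tau\in\mathrm{Typ}(n)$ be types of $n$. The coefficient of $E^+_\tau$ in the expansion of $H_\sigma$ in the basis $\{E^+_\rho:\rho\in\mathrm{Typ}(n)\}$ is $$|\mathcal{PT}^{\mathrm{dyad}}_{\mathrm{dis}}(\sigma, \tau)|.$$
   Context: A type of $n$ is a sequence $\tau=(\tau|^1,\tau|^2,\dots)$ of (possibly empty) integer partitions with $\sum_{i\ge1} i\,|\tau|^i|=n$, where $|\tau|^i|$ is the size of the partition $\tau|^i$; $\mathrm{Typ}(n)$ is the set of types of $n$. Each part $d$ of $\tau|^r$ gives a block $d^r$ of $\tau$ (degree $d$, multiplicity $r$; not exponentiation); a type is thus a multiset of blocks. Let $x_{i,j}$ ($i,j\ge 1$) be indeterminates with $\deg x_{i,j}=i$; all series have rational coefficients. A monomial is square-free if every exponent is at most $1$. $H_d$ is the sum of all monomials of degree $d$; $E^+_d$ is the sum of all square-free monomials of degree $d$. For $F\in\{H,E^+\}$, $F_{d^r}$ is obtained from $F_d$ by replacing each $x_{i,j}$ by $x_{i,j}^r$, and $F_\tau=\prod F_{d^r}$ over all blocks $d^r$ of $\tau$ (counted with repetition; empty product $=1$). It is known that $\{F_\tau\}_{\tau\in\mathrm{Typ}(n)}$ is, for each such $F$, a $\mathbb{Q}$-basis of the space $\mathrm{PSym}(n)$ of polysymmetric functions of degree $n$ (power series homogeneous of degree $n$ that are symmetric separately in each variable set $\{x_{i,j}\}_{j\ge1}$). The diagram of a partition $\lambda$ has left-justified rows of $\lambda_1,\lambda_2,\dots$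 cells; the tensor diagram of $\sigma$ is the sequence of diagrams of $\sigma|^1,\sigma|^2,\dots$, the $i$th one being called the $i$th tensor factor. A brick is a nonempty set of consecutive cells in one row; its length is its number of cells. For $k\ge0$, a $k$-brick is a brick whose length is a multiple of $2^k$, carrying the marking $k$. A dyadic polybrick tabloid of shape $\sigma$ and content $\tau$ is a decomposition of the tensor diagram of $\sigma$ into disjoint $k$-bricks (for various $k\ge0$, the markings being part of the data) such that, in each row, whenever $k'>k$ every $k'$-brick appears to the right of every $k$-brick, and such that $\tau$ is the multiset of blocks obtained by taking a block $b^{2^k m}$ for each $k$-brick of length $2^k b$ in the $m$th tensor factor. It is called distinct if in each row of each tensor factor each marking $k$ appears at most once. $\mathcal{PT}^{\mathrm{dyad}}_{\mathrm{dis}}(\sigma,\tau)$ is the set of distinct dyadic polybrick tabloids of shape $\sigma$ and content $\tau$. *)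

(* Defs.v *)
From HB Require Import structures.
From mathcomp Require Import all_boot all_order all_algebra.
From mathcomp Require Import finmap.
From mathcomp.multinomials Require Import monalg.
From mathcomp Require Import boolp classical_sets fsbigop.

Set Implicit Arguments.
Unset Strict Implicit.
Unset Printing Implicit Defensive.

Import GRing.Theory.

Local Open Scope ring_scope.

(* Indices that start at 1 on paper (those of the variables x_{i,j} and of the
   tensor factors) start at 0 here; the shift is made explicit by _.+1. *)

(** * Types *)

Definition is_intpart (s : seq nat) : bool := sorted geq s && (0%N \notin s).

Record intpart := Intpart { parts :> seq nat; _ : is_intpart parts }.

HB.instance Definition _ := [isSub for parts].
HB.instance Definition _ := [Countable of intpart by <:].

(* In a type of n the i-th partition is empty for i > n, since
   i * |tau|^i| <= n; hence it is determined by its first n partitions.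
   [tau i] with [i : 'I_n] is the partition tau|^(i+1). *)
Definition is_type n (t : {ffun 'I_n -> intpart}) : bool :=
  (\sum_(i < n) i.+1 * sumn (t i) == n)%N.

Record typ n := Typ { tfactor : {ffun 'I_n -> intpart}; _ : is_type tfactor }.
Definition tfun n (t : typ n) (i : 'I_n) : intpart := tfactor t i.
Coercion tfun : typ >-> Funclass.

HB.instance Definition _ n := [isSub for @tfactor n].
HB.instance Definition _ n := [Countable of typ n by <:].

Section TypFinite.
Variable n : nat.

Fact intpart_nil : is_intpart [::]. Proof. by []. Qed.

Let code (t : typ n) : {ffun 'I_n -> n.-bseq 'I_n.+1} :=
  [ffun i => insub_bseq n (map inord (t i))].

Let decode (h : {ffun 'I_n -> n.-bseq 'I_n.+1}) : option (typ n) :=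
  insub [ffun i => insubd (Intpart intpart_nil) (map val (h i))].

Fact typ_codeK : pcancel code decode.
Proof.
have le_sumn (s : seq nat) : {in s, forall d, d <= sumn s}%N.
  elim: s => // a s IHs d; rewrite inE => /orP[/eqP->|/IHs led] /=.
    exact: leq_addr.
  exact: leq_trans led (leq_addl _ _).
have size_le (s : seq nat) : 0%N \notin s -> (size s <= sumn s)%N.
  elim: s => //= a s IHs; rewrite inE negb_or => /andP[a0 /IHs les].
  by rewrite -add1n leq_add // lt0n eq_sym.
move=> t; rewrite /decode; have -> : [ffun i => insubd (Intpart intpart_nil)
    (map val (code t i))] = tfactor t; last exact: valK.
apply/ffunP=> i; rewrite !ffunE; apply: val_inj; rewrite /= val_insubd.
have le_n : (sumn (t i) <= n)%N.
  have := valP t; rewrite /is_type => /eqP {2}<-; rewrite (bigD1 i) //=.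
  by apply: leq_trans (leq_addr _ _); rewrite leq_pmull.
have /andP[_ t_pos] := valP (t i).
have -> : map val (insub_bseq n (map (@inord n) (t i))) = t i :> seq nat.
  rewrite /insub_bseq val_insubd size_map (leq_trans (size_le _ t_pos) le_n).
  rewrite -map_comp -[RHS]map_id; apply/eq_in_map=> d dt /=.
  by rewrite inordK // ltnS (leq_trans (le_sumn _ _ dt)).
by rewrite (valP (t i)).
Qed.

HB.instance Definition _ : isFinite (typ n) := PCanIsFinite typ_codeK.

End TypFinite.

(* The block d^r is the pair (d, r): degree d, multiplicity r. *)
Definition blocks n (t : typ n) : seq (nat * nat) :=
  [seq (d, i.+1) | i : 'I_n <- enum 'I_n, d <- parts (t i)].

(** * Power series in the x_{i,j} *)

(* The pair (i, j) stands for the variable x_{i+1,j+1}. *)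
Notation monom := {cmonom (nat * nat)%type}.

Definition pseries : Type := monom -> rat.

Definition deg (m : monom) : nat := (\sum_(v <- finsupp m) v.1.+1 * m v)%N.

Definition squarefree (m : monom) : bool :=
  all (fun v => m v <= 1)%N (finsupp m).

Definition ps_one : pseries := fun m => (m == mone)%:R.

(* A monomial has finitely many factorisations, so the sum is finite. *)
Definition ps_mul (f g : pseries) : pseries := fun m =>
  \sum_(p \in [set p : monom * monom | mmul p.1 p.2 = m]%classic)
     f p.1 * g p.2.

(* The substitution x_{i,j} |-> x_{i,j}^r, for r > 0: the coefficient of m is
   the sum of the coefficients of the (at most one) m' such that m'^r = m. *)
Definition ps_pow_subst (r : nat) (f : pseries) : pseries := fun m =>
  \sum_(m' \in [set m' : monom | expcmn m' r = m]%classic) f m'.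

Definition H (d : nat) : pseries := fun m => (deg m == d)%:R.

Definition Eplus (d : nat) : pseries :=
  fun m => ((deg m == d) && squarefree m)%:R.

Definition type_prod (F : nat -> pseries) n (t : typ n) : pseries :=
  \big[ps_mul/ps_one]_(b <- blocks t) ps_pow_subst b.2 (F b.1).

Definition Eplus_expansion n (f : pseries) (c : {ffun typ n -> rat}) : Prop :=
  forall m : monom, f m = \sum_(rho : typ n) c rho * type_prod Eplus rho m.

(** * Dyadic polybrick tabloids *)

(* (i, r, c): the cell in row r and column c of the tensor factor i.+1.  For a
   type of n all rows and columns are indexed below n. *)
Definition cell (n : nat) : finType := ('I_n * 'I_n * 'I_n)%type.

Definition diagram n (s : typ n) : {set cell n} :=
  [set x : cell n | (x.2 < nth 0 (s x.1.1) x.1.2)%N].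

(* A marked brick: its tensor factor, row, first column, length and marking.
   The length is at most n, so that 2 ^ k <= length forces k < n. *)
Record brick (n : nat) := Brick {
  bfactor : 'I_n;
  brow : 'I_n;
  bstart : 'I_n;
  blen : 'I_n.+1;
  bmark : 'I_n
}.

Section BrickFinite.
Variable n : nat.

Let code (b : brick n) := (bfactor b, brow b, bstart b, blen b, bmark b).
Let decode (x : 'I_n * 'I_n * 'I_n * 'I_n.+1 * 'I_n) : brick n :=
  let: (i, r, c, l, k) := x in Brick i r c l k.

Fact brick_codeK : cancel code decode. Proof. by case. Qed.

HB.instance Definition _ := Finite.copy (brick n) (can_type brick_codeK).

End BrickFinite.

Definition bcells n (b : brick n) : {set cell n} :=
  [set x : cell n | [&& x.1.1 == bfactor b, x.1.2 == brow b
                      & (bstart b <= x.2 < bstart b + blen b)%N]].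

Definition same_row n (b b' : brick n) : bool :=
  (bfactor b == bfactor b') && (brow b == brow b').

Definition is_kbrick n (b : brick n) : bool :=
  (0 < blen b)%N && (2 ^ bmark b %| blen b)%N.

(* The inclusion [bstart b + blen b <= n] rules out bricks whose recorded
   length exceeds their number of cells. *)
Definition is_decomposition n (s : typ n) (T : {set brick n}) : bool :=
  [&& [forall b in T, is_kbrick b && (bstart b + blen b <= n)%N],
      [forall b in T, forall b' in T,
         (b != b') ==> [disjoint bcells b & bcells b']]
    & \bigcup_(b in T) bcells b == diagram s].

Definition marks_increase n (T : {set brick n}) : bool :=
  [forall b in T, forall b' in T,
     same_row b b' && (bmark b < bmark b')%N
     ==> (bstart b + blen b <= bstart b')%N].

Definition content n (T : {set brick n}) : seq (nat * nat) :=
  [seq (blen b %/ 2 ^ bmark b, 2 ^ bmark b * (bfactor b).+1)%N | b <- enum T].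

Definition is_tabloid n (s t : typ n) (T : {set brick n}) : bool :=
  [&& is_decomposition s T, marks_increase T & perm_eq (content T) (blocks t)].

Definition is_distinct n (T : {set brick n}) : bool :=
  [forall b in T, forall b' in T,
     same_row b b' && (bmark b == bmark b') ==> (b == b')].

Definition PTdyad_dis n (s t : typ n) : {set {set brick n}} :=
  [set T | is_tabloid s t T && is_distinct T].

(* Main.v *)
Require Import Defs.
From HB Require Import structures.
From mathcomp Require Import finmap.
From mathcomp.multinomials Require Import monalg.
From mathcomp Require Import boolp classical_sets fsbigop.
From mathcomp Require Import all_boot all_order all_algebra zify.

(* A monomial is uniquely the product over k of the 2^k-th powers of squarefree
   monomials, its binary digits; hence H_d is the sum, over the sequences of
   lengths l_k divisible by 2^k with sum d, of the products of the
   E+_{(l_k/2^k)^(2^k)}.  Such a sequence is the same thing as a row of length d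
   of a distinct dyadic polybrick tabloid, because the order of the bricks in a
   row is forced by their markings.  Multiplying over the rows of sigma expands
   H_sigma with the announced coefficients.

   The E+_tau are linearly independent by triangularity.  To a type t attach the
   monomial x^t = prod_j x_{d_j, j}^{r_j} over its blocks d_j^{r_j}.  It occurs
   in E+_t; if it occurs in E+_u then the blocks of u are obtained from those of
   t by splitting multiplicities and merging blocks of the same multiplicity.
   Merging increases sum r d^2 and splitting preserves it while increasing the
   number of blocks, so t is minimal for the lexicographic order given by these
   two quantities among the u such that x^t occurs in E+_u, and a maximal t in a
   linear relation gives a contradiction. *)

Set Implicit Arguments.
Unset Strict Implicit.
Unset Printing Implicit Defensive.

Import Order.TTheory GRing.Theory Num.Theory.

Local Open Scope ring_scope.

(** * The ring of power series *)

Lemma expcmnE (m : monom) r v : expcmn m r v = (r * m v)%N.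
Proof.
elim: r => [|[|r] IHr]; rewrite ?mul0n ?mul1n //; first exact: onecmE.
by rewrite /expcmn !(iteropS (onecm _)) iterS mulcmE -(iteropS (onecm _)) IHr mulSn.
Qed.

Lemma mmul_eqP (a b m : monom) :
  reflect (forall v, (a v + b v)%N = m v) (mmul a b == m).
Proof. by apply: (iffP (cmP _ _)) => e v; have := e v; rewrite cmM. Qed.

(** A finite list of candidates: a divisor of m is supported in [finsupp m] and its exponents are at
    most [mdeg m]. Since [divcm] subtracts exponents with truncation, the test in the filter is
    divisibility. *)
Definition divisors_of (m : monom) : seq monom :=
  undup [seq a <- [seq mkcmonom [fsfun v : finsupp m => (h v : nat) | 0%N]
       | h : {ffun finsupp m -> 'I_(mdeg m).+1}]
     | mmul a (divcm m a) == m].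

Lemma mem_divisors_of (a m : monom) :
  (a \in divisors_of m) = (mmul a (divcm m a) == m).
Proof.
rewrite mem_undup mem_filter; apply: andb_idr => /mmul_eqP am.
apply/mapP; exists [ffun v : finsupp m => inord (a (val v))]; rewrite ?mem_enum //.
have le_mdeg v : (m v <= mdeg m)%N.
  case: (boolP (v \in finsupp m)) => [vm|/fsfun_dflt -> //].
  by rewrite /mdeg (big_fsetD1 v) //= leq_addr.
apply/eqP/cmP => v; rewrite cmE /= fsfun_ffun; case: insubP => [u vm uv|] /=.
  by rewrite ffunE inordK uv // ltnS (leq_trans _ (le_mdeg v)) // -(am v) leq_addr.
move=> /fsfun_dflt mv; move: (am v).
by rewrite mv => /eqP; rewrite addn_eq0 => /andP[/eqP].
Qed.

Lemma mmul_divisors (a b m : monom) :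
  mmul a b = m -> (a \in divisors_of m) * (b \in divisors_of m).
Proof.
move=> /eqP/mmul_eqP ab; rewrite !mem_divisors_of.
by split; apply/mmul_eqP => v; rewrite divcmE -ab ?addKn ?addnK // addnC.
Qed.

Lemma divisors_trans (a b m : monom) :
  a \in divisors_of b -> b \in divisors_of m -> a \in divisors_of m.
Proof.
rewrite !mem_divisors_of => /eqP ab /eqP bm.
by rewrite -mem_divisors_of -bm -ab -mulmA (mmul_divisors (erefl _)).
Qed.

(** Both factors of a factorisation of m divide m, so the sum becomes a finite double sum with an
    indicator. A longer list than the divisors is allowed, so that products at different monomials
    can be computed over one common list. *)
Lemma ps_mul_divisors (D : seq monom) (f g : pseries) m :
    uniq D -> {subset divisors_of m <= D} ->
  ps_mul f g m = \sum_(a <- D) \sum_(b <- D) (mmul a b == m)%:R * (f a * g b).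
Proof.
move=> D_uniq mD; rewrite -(big_allpairs (F := fun p : monom * monom =>
  (mmul p.1 p.2 == m)%:R * (f p.1 * g p.2))) /=.
rewrite /ps_mul.
under eq_fsbigr => p /set_mem/= pm do
  rewrite -[f _ * g _]mul1r -[1]/(true%:R) -{1}(introT eqP pm).
apply: fsbig_fwiden => [[a b] /= /mmul_divisors[am bm]||[a b] [_ /eqP/negPf]] /=.
- by rewrite /= allpairs_f ?mD.
- by apply: allpairs_uniq => // -[? ?] [? ?].
- by move=> /= ->; rewrite mul0r.
Qed.

Lemma sum_pick (T : eqType) (D : seq T) (q : T) (X : T -> rat) :
  uniq D -> \sum_(p <- D) (q == p)%:R * X p = (q \in D)%:R * X q.
Proof.
move=> D_uniq; case: (boolP (q \in D)) => [qD|/negP qD].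
  rewrite (bigD1_seq q) //= eqxx big1 ?addr0 // => p.
  by rewrite eq_sym => /negPf ->; rewrite mul0r.
rewrite mul0r big_seq big1 // => p pD.
by case: eqP => [qp|]; rewrite ?mul0r //; case: qD; rewrite qp.
Qed.

Lemma ps_mulC : commutative ps_mul.
Proof.
move=> f g; apply/funext => m.
rewrite !(@ps_mul_divisors (divisors_of m)) ?undup_uniq // exchange_big /=.
apply: eq_bigr => a _; apply: eq_bigr => b _.
by rewrite mulmC [f b * _]mulrC.
Qed.

(** A form symmetric in the three factors, from which associativity follows by permuting sums. *)
Lemma ps_mul3E (f g h : pseries) m : ps_mul f (ps_mul g h) m =
  \sum_(a <- divisors_of m) \sum_(b <- divisors_of m) \sum_(c <- divisors_of m)
    (mmul a (mmul b c) == m)%:R * (f a * (g b * h c)).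
Proof.
rewrite !(@ps_mul_divisors (divisors_of m)) ?undup_uniq //; apply: eq_bigr => a _.
(* The product p = bc becomes a summation variable so that the sums can be exchanged; [sum_pick]
   then removes it, because bc divides m whenever a(bc) = m. *)
have -> : \sum_(p <- divisors_of m) (mmul a p == m)%:R * (f a * ps_mul g h p) =
  \sum_(p <- divisors_of m) \sum_(b <- divisors_of m) \sum_(c <- divisors_of m)
    (mmul b c == p)%:R * ((mmul a p == m)%:R * (f a * (g b * h c))).
  apply: eq_big_seq => p pm.
  rewrite (@ps_mul_divisors (divisors_of m)) ?undup_uniq //; last first.
    by move=> b /divisors_trans; exact.
  rewrite !mulr_sumr; apply: eq_bigr => b _; rewrite !mulr_sumr.
  by apply: eq_bigr => c _; rewrite [f a * _]mulrCA [RHS]mulrCA.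
rewrite exchange_big; apply: eq_bigr => b _.
rewrite exchange_big; apply: eq_bigr => c _.
rewrite sum_pick ?undup_uniq //; case: eqP => [/mmul_divisors[_ ->]|_].
  by rewrite mul1r.
by rewrite !mul0r mulr0.
Qed.

Lemma ps_mulA : associative ps_mul.
Proof.
move=> f g h; apply/funext => m; rewrite [RHS](congr1 (@^~ m) (ps_mulC _ _)).
rewrite !ps_mul3E [RHS]exchange_big; apply: eq_bigr => a _ /=.
rewrite [RHS]exchange_big; apply: eq_bigr => b _ /=; apply: eq_bigr => c _.
by rewrite [mmul c _]mulmC -mulmA [h c * _]mulrC -mulrA.
Qed.

Lemma ps_mul1s : left_id ps_one ps_mul.
Proof.
move=> f; apply/funext => m; rewrite (@ps_mul_divisors (divisors_of m)) ?undup_uniq //.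
rewrite exchange_big /=.
transitivity (\sum_(b <- divisors_of m) \sum_(a <- divisors_of m)
  (mone == a)%:R * ((mmul a b == m)%:R * f b)).
  apply: eq_bigr => b _; apply: eq_bigr => a _.
  by rewrite mulrCA /ps_one [a == mone]eq_sym.
have [one_m m_m] := mmul_divisors (mul1m m).
under eq_bigr => b _ do rewrite sum_pick ?undup_uniq // one_m mul1r mul1m eq_sym.
by rewrite sum_pick ?undup_uniq // m_m mul1r.
Qed.

Definition ps_add (f g : pseries) : pseries := fun m => f m + g m.
Definition ps_opp (f : pseries) : pseries := fun m => - f m.
Definition ps_zero : pseries := fun=> 0.

Fact ps_addA : associative ps_add.
Proof. by move=> f g h; apply/funext => m; exact: addrA. Qed.
Fact ps_addC : commutative ps_add.
Proof. by move=> f g; apply/funext => m; exact: addrC. Qed.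
Fact ps_add0s : left_id ps_zero ps_add.
Proof. by move=> f; apply/funext => m; exact: add0r. Qed.
Fact ps_addNs : left_inverse ps_zero ps_opp ps_add.
Proof. by move=> f; apply/funext => m; exact: addNr. Qed.

HB.instance Definition _ := gen_eqMixin pseries.
HB.instance Definition _ := gen_choiceMixin pseries.
HB.instance Definition _ :=
  GRing.isZmodule.Build pseries ps_addA ps_addC ps_add0s ps_addNs.

Fact ps_mulDl : left_distributive ps_mul (@GRing.add pseries).
Proof.
move=> f g h; apply/funext => m.
rewrite /GRing.add /= /ps_add !(@ps_mul_divisors (divisors_of m)) ?undup_uniq //.
rewrite -big_split; apply: eq_bigr => a _; rewrite -big_split.
by apply: eq_bigr => b _; rewrite /= !mulrDl mulrDr.
Qed.

HB.instance Definition _ := GRing.Zmodule_isComPzRing.Build pseries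
  ps_mulA ps_mulC ps_mul1s ps_mulDl.

Lemma ps_coef_sum (I : Type) (r : seq I) (P : pred I) (F : I -> pseries) m :
  (\sum_(i <- r | P i) F i) m = \sum_(i <- r | P i) F i m.
Proof. exact: (big_morph (fun f : pseries => f m)). Qed.

Lemma type_prodE (F : nat -> pseries) n (t : typ n) :
  type_prod F t = \prod_(b <- blocks t) ps_pow_subst b.2 (F b.1).
Proof. by []. Qed.

(** * Substitution of r-th powers of the variables *)

Lemma expcmn_inj r : (0 < r)%N -> injective (expcmn (I := (nat * nat)%type) ^~ r).
Proof.
move=> r_gt0 a b /= ab; apply/eqP/cmP => v.
have := congr1 (fun m : monom => m v) ab.
by rewrite /= !expcmnE => /eqP; rewrite eqn_pmul2l // => /eqP.
Qed.

Lemma expcmnM (a b : monom) r :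
  expcmn (mmul a b) r = mmul (expcmn a r) (expcmn b r).
Proof. by apply/eqP/cmP => v; rewrite cmM !expcmnE cmM mulnDr. Qed.

Lemma expcmn_mul (a : monom) r s : expcmn a (r * s) = expcmn (expcmn a r) s.
Proof. by apply/eqP/cmP => v; rewrite !expcmnE mulnA [(s * r)%N]mulnC. Qed.

Lemma ps_pow_subst_expcmn r (f : pseries) m :
  (0 < r)%N -> ps_pow_subst r f (expcmn m r) = f m.
Proof.
move=> r_gt0; rewrite /ps_pow_subst -[RHS](fsbig_set1 +%R).
by apply: eq_fsbigl; apply/seteqP; split=> a /= => [/expcmn_inj -> | ->].
Qed.

Lemma ps_pow_subst_neq0 r (f : pseries) m :
  ps_pow_subst r f m != 0 -> exists a, m = expcmn a r.
Proof.
apply: contra_neqP => no_root; apply: fsbig1 => a ra.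
by case: no_root; exists a.
Qed.

(** Both sides vanish off the r-th powers. At m'^r the only contributing factorisations are those
    into two r-th powers, and they correspond bijectively to the factorisations of m'. *)
Lemma ps_pow_substM r (f g : pseries) : (0 < r)%N ->
  ps_pow_subst r (f * g) = ps_pow_subst r f * ps_pow_subst r g.
Proof.
move=> r_gt0; apply/funext => m; apply/esym.
have [[m' ->]|no_root] := pselect (exists a, m = expcmn a r); last first.
  rewrite [RHS]fsbig1; last by move=> a ma; case: no_root; exists a.
  apply: fsbig1 => -[a b] /= abm; apply/eqP; apply: contra_notT no_root.
  rewrite mulf_eq0 negb_or => /andP[/ps_pow_subst_neq0[a' ea] /ps_pow_subst_neq0[b' eb]].
  by exists (mmul a' b'); rewrite -abm ea eb expcmnM.
rewrite ps_pow_subst_expcmn //.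
pose h (p : monom * monom) := (expcmn p.1 r, expcmn p.2 r).
pose A := [set p : monom * monom | mmul p.1 p.2 = m']%classic.
transitivity (\sum_(p \in (h @` A)%classic)
    ps_pow_subst r f p.1 * ps_pow_subst r g p.2).
  apply/esym/fsbig_widen => [_ /= [[a b] /= <- <-]|[a b] [/= abm not_h]].
    by rewrite expcmnM.
  apply/eqP; apply: contra_notT not_h.
  rewrite mulf_eq0 negb_or => /andP[/ps_pow_subst_neq0[a' ea] /ps_pow_subst_neq0[b' eb]].
  exists (a', b'); rewrite /h /= ?ea ?eb //; apply: (expcmn_inj r_gt0).
  by rewrite expcmnM -ea -eb.
rewrite fsbig_image; last first.
  move=> [a b] [a' b'] _ _ [/(expcmn_inj r_gt0) -> /(expcmn_inj r_gt0) ->] //.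
by apply: eq_fsbigr => p _; rewrite /= !ps_pow_subst_expcmn.
Qed.

Lemma ps_pow_subst1 r : (0 < r)%N -> ps_pow_subst r 1 = 1.
Proof.
move=> r_gt0; apply/funext => m.
have one_r : expcmn (mone : monom) r = mone.
  by apply/eqP/cmP => v; rewrite expcmnE !cm1 muln0.
have [[m' ->]|no_root] := pselect (exists a, m = expcmn a r); last first.
  rewrite [LHS]fsbig1; last by move=> a ma; case: no_root; exists a.
  rewrite [RHS]/GRing.one /= /ps_one; case: eqP => // m1.
  by case: no_root; exists mone; rewrite one_r.
rewrite ps_pow_subst_expcmn // /GRing.one /= /ps_one -{2}one_r.
by rewrite (inj_eq (expcmn_inj r_gt0)).
Qed.

Lemma ps_pow_subst_prod r (I : Type) (s : seq I) (P : pred I) (F : I -> pseries) :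
  (0 < r)%N ->
  ps_pow_subst r (\prod_(i <- s | P i) F i) =
  \prod_(i <- s | P i) ps_pow_subst r (F i).
Proof.
move=> r_gt0; apply: (big_morph (ps_pow_subst r)); last exact: ps_pow_subst1.
by move=> f g; exact: ps_pow_substM.
Qed.

(** The substituted series is characterised by its values on r-th powers and its vanishing
    elsewhere. *)
Lemma ps_pow_subst_eq r (f g : pseries) : (0 < r)%N ->
  (forall m, g (expcmn m r) = f m) ->
  (forall m, g m != 0 -> exists a, m = expcmn a r) ->
  ps_pow_subst r f = g.
Proof.
move=> r_gt0 gf g0; apply/funext => m.
have [[m' ->]|no_root] := pselect (exists a, m = expcmn a r).
  by rewrite ps_pow_subst_expcmn.
rewrite [LHS]fsbig1; last by move=> a ma; case: no_root; exists a.
by apply/esym/eqP; apply: contra_notT no_root => /g0.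
Qed.

Lemma ps_pow_subst_sum r (I : Type) (s : seq I) (P : pred I) (F : I -> pseries) :
  (0 < r)%N ->
  ps_pow_subst r (\sum_(i <- s | P i) F i) =
  \sum_(i <- s | P i) ps_pow_subst r (F i).
Proof.
move=> r_gt0; apply: ps_pow_subst_eq => // m.
  by rewrite !ps_coef_sum; apply: eq_bigr => i _; rewrite ps_pow_subst_expcmn.
apply: contra_neqP => no_root; rewrite ps_coef_sum big1 // => i _.
by apply/eqP; apply: contra_notT no_root => /ps_pow_subst_neq0.
Qed.

Lemma ps_pow_subst_comp r s (f : pseries) : (0 < r)%N -> (0 < s)%N ->
  ps_pow_subst s (ps_pow_subst r f) = ps_pow_subst (r * s) f.
Proof.
move=> r_gt0 s_gt0; apply/esym/ps_pow_subst_eq => [|m|m].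
- by rewrite muln_gt0 r_gt0.
- by rewrite expcmn_mul !ps_pow_subst_expcmn.
- have [[m' ->]|no_root] := pselect (exists a, m = expcmn a s); last first.
    by move=> /ps_pow_subst_neq0 /no_root.
  rewrite ps_pow_subst_expcmn // => /ps_pow_subst_neq0 [a ->].
  by exists a; rewrite expcmn_mul.
Qed.

(** * Binary digits of monomials *)

Lemma deg_widen (m : monom) (D : {fset nat * nat}) :
  (finsupp m `<=` D)%fset -> deg m = (\sum_(v <- D) v.1.+1 * m v)%N.
Proof.
move=> mD; rewrite /deg (big_fset_incl _ mD) // => v _ /fsfun_dflt ->.
by rewrite muln0.
Qed.

Lemma leq_deg (m : monom) v : (v.1.+1 * m v <= deg m)%N.
Proof.
case: (boolP (v \in finsupp m)) => [vm|/fsfun_dflt ->]; last by rewrite muln0.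
by rewrite /deg (big_fsetD1 v) //= leq_addr.
Qed.

Lemma squarefreeP (m : monom) : reflect (forall v, m v <= 1)%N (squarefree m).
Proof.
apply: (iffP allP) => [sqf v|le1 v _]; last exact: le1.
by case: (boolP (v \in finsupp m)) => [/sqf //|/fsfun_dflt ->].
Qed.

Definition cmap (f : nat -> nat) (m : monom) : monom :=
  mkcmonom [fsfun v in finsupp m => f (m v) | 0%N].

Lemma cmapE f m v : f 0%N = 0%N -> cmap f m v = f (m v).
Proof.
by move=> f0; rewrite cmE fsfun_fun; case: (boolP (v \in _)) => // /fsfun_dflt ->.
Qed.

Lemma finsupp_cmap f m : f 0%N = 0%N -> (finsupp (cmap f m) `<=` finsupp m)%fset.
Proof.
move=> f0; apply/fsubsetP => v; rewrite -!cmE_neq0 cmapE //.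
by apply: contra_neq => ->.
Qed.

Definition digit (k : nat) : monom -> monom := cmap (fun x => x %/ 2 ^ k %% 2)%N.

Lemma digitE k m v : digit k m v = (m v %/ 2 ^ k %% 2)%N.
Proof. by rewrite cmapE // div0n mod0n. Qed.

Lemma squarefree_digit k m : squarefree (digit k m).
Proof. by apply/squarefreeP => v; rewrite digitE -ltnS ltn_mod. Qed.

Lemma dyadic_expansion K x :
  (x < 2 ^ K -> x = \sum_(k < K) 2 ^ k * (x %/ 2 ^ k %% 2))%N.
Proof.
elim: K x => [|K IHK] x; first by rewrite big_ord0 expn0; case: x.
move=> ltx; rewrite big_ord_recl /= expn0 mul1n divn1.
have ltx2 : (x %/ 2 < 2 ^ K)%N by rewrite ltn_divLR // -expnSr.
rewrite {1}(divn_eq x 2) addnC {1}(IHK _ ltx2) big_distrl /=.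
congr addn; apply: eq_bigr => k _.
by rewrite /bump /= add1n mulnAC -expnSr -divnMA -expnS.
Qed.

Lemma deg_digits K (m : monom) : (forall v, m v < 2 ^ K)%N ->
  deg m = (\sum_(k < K) 2 ^ k * deg (digit k m))%N.
Proof.
move=> ltm; transitivity (\sum_(k < K) \sum_(v <- finsupp m)
    2 ^ k * (v.1.+1 * digit k m v))%N; last first.
  apply: eq_bigr => k _; rewrite -big_distrr /=.
  by rewrite (deg_widen (finsupp_cmap _ _)) // div0n mod0n.
rewrite exchange_big /=; apply: eq_bigr => v _.
rewrite {1}(dyadic_expansion (ltm v)) big_distrr /=.
by apply: eq_bigr => k _; rewrite mulnCA digitE.
Qed.

(** A monomial is in exactly one way p s^2 with p square-free: p records the parities of the
    exponents and s their halves. Hence a single term of the product survives. *)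
Lemma Eplus_mul_square a (f : pseries) m :
  (Eplus a * ps_pow_subst 2 f) m = Eplus a (digit 0 m) * f (cmap (divn^~ 2) m).
Proof.
have mE v : (m v = digit 0 m v + 2 * cmap (divn^~ 2) m v)%N.
  by rewrite digitE cmapE ?div0n // divn1 mulnC addnC -divn_eq.
rewrite -[f _](@ps_pow_subst_expcmn 2) //.
set q0 := expcmn _ 2.
rewrite -[RHS](fsbig_set1 +%R (digit 0 m, q0)
  (fun p : monom * monom => Eplus a p.1 * ps_pow_subst 2 f p.2)).
apply/esym/fsbig_widen => [p -> /=|[p q] [/= /eqP/mmul_eqP pq not_dig]].
  by apply/eqP/mmul_eqP => v; rewrite expcmnE -mE.
apply/eqP; apply: contra_notT not_dig => /=.
rewrite mulf_eq0 negb_or => /andP[Ep /ps_pow_subst_neq0[s es]].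
have sqf : squarefree p by move: Ep; rewrite /Eplus; case: squarefree; rewrite ?andbF.
have dv v : (m v = s v * 2 + p v)%N by rewrite -pq es expcmnE mulnC addnC.
have p_lt v : (p v < 2)%N by rewrite ltnS; exact/squarefreeP.
rewrite es /q0; congr (_, expcmn _ _); apply/eqP/cmP => v.
  by rewrite digitE divn1 dv modnMDl modn_small.
by rewrite cmapE ?div0n // dv divnMDl // divn_small ?addn0.
Qed.

(** Induction on K by splitting off the lowest binary digit. The last factor says that no exponent
    has a digit at position K or beyond. *)
Lemma prod_Eplus_dyadic K (a : nat -> nat) m :
  (\prod_(k < K) ps_pow_subst (2 ^ k) (Eplus (a k))) m =
  \prod_(k < K) Eplus (a k) (digit k m) * (cmap (divn^~ (2 ^ K)%N) m == mone)%:R.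
Proof.
elim: K a m => [|K IHK] a m.
  rewrite !big_ord0 mul1r; congr (_ == _)%:R; apply/eqP/cmP => v.
  by rewrite cmapE ?div0n // divn1.
rewrite !big_ord_recl /=.
have -> : ps_pow_subst (2 ^ 0) (Eplus (a 0%N)) = Eplus (a 0%N).
  by apply: ps_pow_subst_eq => // x _; exists x.
(* All factors but the first are series in the squares of the variables, so one squaring can be
   pulled out of their product. *)
have -> : \prod_(i < K) ps_pow_subst (2 ^ bump 0 i) (Eplus (a (bump 0 i))) =
   ps_pow_subst 2 (\prod_(i < K) ps_pow_subst (2 ^ i) (Eplus (a i.+1))).
  rewrite ps_pow_subst_prod //; apply: eq_bigr => i _.
  by rewrite ps_pow_subst_comp ?expn_gt0 // -expnSr.
rewrite Eplus_mul_square (IHK (fun k => a k.+1)) -mulrA; congr (_ * (_ * _)).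
  apply: eq_bigr => i _; congr Eplus; apply/eqP/cmP => v.
  by rewrite !digitE cmapE ?div0n // -divnMA -expnS.
congr (_ == _)%:R; apply/eqP/cmP => v.
by rewrite !cmapE ?div0n // -divnMA -expnS.
Qed.

Lemma cmap_divn_eq1 K (m : monom) :
  reflect (forall v, m v < 2 ^ K)%N (cmap (divn^~ (2 ^ K)%N) m == mone).
Proof.
have K_gt0 : (0 < 2 ^ K)%N by rewrite expn_gt0.
apply: (iffP (cmP _ _)) => e v; have := e v; rewrite cmapE ?div0n // cm1.
  by move=> /eqP; rewrite -leqn0 leqNgt divn_gt0 // -ltnNge.
exact: divn_small.
Qed.

(** Describes a row of d cells in a distinct tabloid: [l k] is the length of its unique brick marked
    k, or 0 if there is none. *)
Definition dyadic_lengths n (d : nat) (l : {ffun 'I_n -> 'I_n.+1}) : bool :=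
  [forall k : 'I_n, 2 ^ k %| l k]%N && (\sum_k l k == d)%N.

(** At a monomial m of degree d exactly one sequence contributes, the one read off the degrees of
    the binary digits of m; at other degrees none does. *)
Lemma H_dyadic n d : (d <= n)%N ->
  H d = \sum_(l : {ffun 'I_n -> 'I_n.+1} | dyadic_lengths d l)
          \prod_(k < n) ps_pow_subst (2 ^ k) (Eplus (l k %/ 2 ^ k)).
Proof.
move=> le_dn; apply/funext => m; rewrite ps_coef_sum.
have termE (l : {ffun 'I_n -> 'I_n.+1}) :
   (\prod_(k < n) ps_pow_subst (2 ^ k) (Eplus (l k %/ 2 ^ k))) m =
   (([forall k : 'I_n, deg (digit k m) == l k %/ 2 ^ k]%N) &&
     (cmap (divn^~ (2 ^ n)%N) m == mone))%:R.
  (* The lengths are extended by 0 from ['I_n] to all naturals, as the product formula expects. *)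
  have := prod_Eplus_dyadic n
    (fun k => oapp (fun k' : 'I_n => l k' %/ 2 ^ k')%N 0%N (insub k)) m.
  under eq_bigr => k _ do rewrite valK.
  under [X in _ = X * _]eq_bigr => k _ do rewrite valK.
  move=> /= ->; rewrite -mulnb natrM; congr (_ * _).
  case: forallP => [all_k|not_all].
    by rewrite big1 // => k _; rewrite /Eplus all_k squarefree_digit.
  have [k /negPf nk] : exists k : 'I_n, (deg (digit k m) != l k %/ 2 ^ k)%N.
    by apply/existsP; rewrite -negb_forall; apply/forallP.
  by rewrite (bigD1 k) //= /Eplus nk mul0r.
under eq_bigr => l _ do rewrite termE.
rewrite /H; case: eqP => [dm|dm]; last first.
  rewrite big1 // => l /andP[/forallP dvd_l /eqP sum_l].
  case: andP => // -[/forallP dig /cmap_divn_eq1 ltm]; case: dm.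
  rewrite (deg_digits ltm) -sum_l; apply: eq_bigr => k _.
  by rewrite (eqP (dig k)) mulnC divnK.
have le_deg : (deg m <= n)%N by rewrite dm.
(* Exponents are at most deg m <= n < 2^n, so the markings below n reach all digits. *)
have ltm : forall v, (m v < 2 ^ n)%N.
  move=> v; apply: leq_ltn_trans (ltn_expl n (ltnSn 1)).
  by apply: leq_trans le_deg; apply: leq_trans (leq_deg m v); rewrite leq_pmull.
have degE := deg_digits ltm.
(* The only possible lengths; [inord] changes nothing because each summand of deg m is at most n. *)
pose l0 : {ffun 'I_n -> 'I_n.+1} := [ffun k : 'I_n => inord (2 ^ k * deg (digit k m))].
have l0E k : l0 k = (2 ^ k * deg (digit k m))%N :> nat.
  rewrite ffunE inordK // ltnS; apply: leq_trans le_deg.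
  by rewrite degE (bigD1 k) //= leq_addr.
have two_gt0 k : (0 < 2 ^ k)%N by rewrite expn_gt0.
have l0_ok : dyadic_lengths d l0.
  apply/andP; split; first by apply/forallP => k; rewrite l0E dvdn_mulr.
  by rewrite -dm degE; apply/eqP/eq_bigr => k _; rewrite l0E.
rewrite (bigD1 l0) //= big1 ?addr0 => [|l /andP[/andP[/forallP dvd_l _] l_neq]].
  rewrite (introT (cmap_divn_eq1 _ _)) // andbT (introT forallP) // => k.
  by rewrite l0E mulKn.
case: forallP => // dig; case/eqP: l_neq; apply/ffunP => k; apply/val_inj.
by rewrite /= l0E (eqP (dig k)) mulnC divnK.
Qed.

(** * Types and dyadic tabloids *)

Section Types.
Variable n : nat.
Implicit Types (t : typ n) (f : {ffun 'I_n -> intpart}) (bs : seq (nat * nat)).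

(** The block list of a family of partitions not yet known to be a type; [blocks_ex] needs it to
    establish the weight condition. *)
Let blocks_ffun f : seq (nat * nat) :=
  [seq (d, i.+1) | i : 'I_n <- enum 'I_n, d <- parts (f i)].

Let big_blocks_ffun (R : Type) (idx : R) (op : Monoid.com_law idx) f
    (F : nat * nat -> R) :
  \big[op/idx]_(b <- blocks_ffun f) F b =
  \big[op/idx]_(i < n) \big[op/idx]_(d <- f i) F (d, i.+1).
Proof. by rewrite big_allpairs_dep big_enum. Qed.

Lemma big_blocks (R : Type) (idx : R) (op : Monoid.com_law idx) t
    (F : nat * nat -> R) :
  \big[op/idx]_(b <- blocks t) F b =
  \big[op/idx]_(i < n) \big[op/idx]_(d <- t i) F (d, i.+1).
Proof. exact: big_blocks_ffun. Qed.

Lemma weight_blocks t : (\sum_(b <- blocks t) b.1 * b.2 = n)%N.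
Proof.
rewrite big_blocks -[RHS](eqP (valP t)); apply: eq_bigr => i _ /=.
by rewrite sumnE big_distrr; apply: eq_bigr => d _; rewrite mulnC.
Qed.

Lemma blocks_gt0 t b : b \in blocks t -> (0 < b.1)%N && (0 < b.2)%N.
Proof.
move=> /allpairsPdep[i [d [_ dt ->]]] /=; rewrite andbT lt0n.
by have /andP[_ /memPn] := valP (t i); apply.
Qed.

Let count_blocks f d r : count_mem (d, r) (blocks_ffun f) =
  (\sum_(i < n | i.+1 == r) count_mem d (f i))%N.
Proof.
rewrite -sum1_count big_mkcond big_blocks_ffun [RHS]big_mkcond /=.
apply: eq_bigr => i _; rewrite -sum1_count [in RHS]big_mkcond /=.
case: (eqVneq i.+1 r) => [<-|ne]; last first.
  by rewrite big1 // => e _; rewrite xpair_eqE (negPf ne) andbF.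
by apply: eq_bigr => e _; rewrite xpair_eqE eqxx andbT.
Qed.

(** The multiplicities of the blocks give those of the parts of each partition, and a partition is a
    sorted list. *)
Lemma blocks_inj t t' : perm_eq (blocks t) (blocks t') -> t = t'.
Proof.
move=> /permP eq_count; apply/val_inj/ffunP => i; apply: val_inj => /=.
have [/andP[t_sorted _] /andP[t'_sorted _]] := (valP (t i), valP (t' i)).
apply: (sorted_eq (leT := geq)) t_sorted t'_sorted _.
- by move=> a b c /= ba ac; exact: leq_trans ac ba.
- by move=> a b /=; rewrite andbC => /anti_leq.
have cnt (u : typ n) d : count_mem (d, i.+1) (blocks u) = count_mem d (u i).
  by rewrite [LHS]count_blocks (big_pred1 i) // => j /=; rewrite eqSS.
by apply/allP => d _ /=; rewrite -!cnt eq_count.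
Qed.

Lemma blocks_ex bs : all (fun b => (0 < b.1) && (0 < b.2))%N bs ->
  (\sum_(b <- bs) b.1 * b.2 = n)%N -> exists t, perm_eq (blocks t) bs.
Proof.
move=> bs_gt0 bs_sum.
have i_part (i : 'I_n) :
    is_intpart (sort geq [seq b.1 | b <- bs & b.2 == i.+1]).
  rewrite /is_intpart sort_sorted; last by move=> x y; exact: leq_total.
  rewrite mem_sort; apply/mapP => -[b]; rewrite mem_filter => /andP[_ b_bs] b0.
  by have := allP bs_gt0 _ b_bs; rewrite -b0.
pose f : {ffun 'I_n -> intpart} := [ffun i => Intpart (i_part i)].
have fE (i : 'I_n) : f i = sort geq [seq b.1 | b <- bs & b.2 == i.+1] :> seq nat.
  by rewrite ffunE.
have f_bs : perm_eq (blocks_ffun f) bs.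
  apply/allP => -[d r] _ /=; rewrite count_blocks; apply/eqP.
  under eq_bigr => i ir do
    rewrite fE (permP (permEl (perm_sort _ _))) count_map count_filter (eqP ir).
  have cnt_bs : count (predI (preim fst (pred1 d)) (fun b => b.2 == r)) bs =
      count_mem (d, r) bs by apply: eq_count => -[d' r'].
  case: (boolP ((d, r) \in bs)) => [dr_bs|/count_memPn dr_bs]; last first.
    by rewrite big1 // => i _; rewrite cnt_bs.
  have /andP[/= d_gt0 r_gt0] := allP bs_gt0 _ dr_bs.
  (* A block of positive degree in a list of weight n has multiplicity at most n, so it belongs to
     one of the n tensor factors. *)
  have r_le : (r.-1 < n)%N.
    rewrite prednK // -bs_sum (big_rem _ dr_bs) /=.
    by apply: leq_trans (leq_addr _ _); rewrite leq_pmull.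
  rewrite (big_pred1 (Ordinal r_le)) // => i /=.
  by rewrite -[RHS]val_eqE /= -[RHS]eqSS prednK.
have f_type : is_type f.
  rewrite /is_type -[eqbRHS]bs_sum -(perm_big _ f_bs) big_blocks_ffun /=.
  apply/eqP/eq_bigr => i _; rewrite sumnE big_distrr.
  by apply: eq_bigr => d _; rewrite mulnC.
by exists (Typ f_type).
Qed.

End Types.

(** * Distinct dyadic tabloids described row by row *)

Section Tabloids.
Variables (n : nat) (s : typ n).
Implicit Types (T : {set brick n}) (b : brick n) (x : 'I_n * 'I_n) (k : 'I_n).
Local Open Scope nat_scope.

Definition brick_row b : 'I_n * 'I_n := (bfactor b, brow b).
Definition brick_end b : nat := bstart b + blen b.
Definition row_length x : nat := nth 0 (s x.1) x.2.

Lemma same_rowE b b' : same_row b b' = (brick_row b == brick_row b').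
Proof. by []. Qed.

Lemma sumn_le (i : 'I_n) : sumn (s i) <= n.
Proof.
have := valP s; rewrite /is_type => /eqP {2}<-; rewrite (bigD1 i) //=.
by apply: leq_trans (leq_addr _ _); rewrite leq_pmull.
Qed.

Lemma size_type_le (i : 'I_n) : size (s i) <= n.
Proof.
apply: leq_trans (sumn_le i); have /andP[_ s_gt0] := valP (s i).
have {s_gt0} : 0 \notin parts (s i) by [].
elim: (parts (s i)) => //= a u IHu; rewrite inE negb_or => /andP[a0 /IHu le_u].
by rewrite -add1n leq_add // lt0n eq_sym.
Qed.

Lemma row_length_le x : row_length x <= n.
Proof.
apply: leq_trans (sumn_le x.1); rewrite /row_length.
have [x_in|x_out] := ltnP x.2 (size (s x.1)); last by rewrite nth_default.
by rewrite sumnE (big_nth 0) big_mkord (bigD1 (Ordinal x_in)) //= leq_addr.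
Qed.

(** The content is left free, because the expansion of H_sigma first sums over tabloids of all
    contents. *)
Definition is_dyadic_tabloid T : bool :=
  [&& is_decomposition s T, marks_increase T & is_distinct T].

Record dyadic_tabloid T : Prop := DyadicTabloid {
  tab_kbrick b : b \in T -> 0 < blen b /\ 2 ^ bmark b %| blen b;
  tab_end b : b \in T -> brick_end b <= row_length (brick_row b);
  tab_cover x j : j < row_length x ->
    exists2 b, b \in T & brick_row b = x /\ bstart b <= j < brick_end b;
  tab_marks b b' : b \in T -> b' \in T -> brick_row b = brick_row b' ->
    bmark b < bmark b' -> brick_end b <= bstart b';
  tab_distinct b b' : b \in T -> b' \in T -> brick_row b = brick_row b' ->
    bmark b = bmark b' -> b = b'
}.

Lemma in_bcells b x (j : 'I_n) :
  ((x, j) \in bcells b) = (brick_row b == x) && (bstart b <= j < brick_end b).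
Proof. by case: x => i r; rewrite inE xpair_eqE /= andbA (eq_sym i) (eq_sym r). Qed.

Lemma in_diagram x (j : 'I_n) : ((x, j) \in diagram s) = (j < row_length x).
Proof. by rewrite inE. Qed.

Lemma dyadic_tabloidP T : reflect (dyadic_tabloid T) (is_dyadic_tabloid T).
Proof.
apply: (iffP and3P) => [[/and3P[kbr disj /eqP cov] marks dist]|[kbr tend cov marks dist]].
  have kbrick b (bT : b \in T) := implyP (forallP kbr b) bT.
  have end_le b : b \in T -> brick_end b <= n by move=> /kbrick/andP[].
  split.
  - by move=> b /kbrick/andP[/andP[]].
  - move=> b bT; have /andP[/andP[len_gt0 _] _] := kbrick b bT.
    have end_gt0 : 0 < brick_end b by rewrite addn_gt0 len_gt0 orbT.
    (* The last cell of the brick lies in the diagram, which bounds the end of the brick by the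
       length of its row. *)
    have end_lt : (brick_end b).-1 < n by rewrite prednK ?end_le.
    rewrite -(prednK end_gt0) -[_.-1]/(val (Ordinal end_lt)) -in_diagram -cov.
    apply/bigcupP; exists b => //; rewrite in_bcells eqxx /= ltn_predL end_gt0 andbT.
    by rewrite -ltnS prednK // -addn1 leq_add.
  - move=> x j jx; have jn : j < n by apply: leq_trans jx (row_length_le x).
    have : (x, Ordinal jn) \in diagram s by rewrite in_diagram.
    rewrite -cov => /bigcupP[b bT]; rewrite in_bcells => /andP[/eqP bx jb].
    by exists b.
  - move=> b b' bT b'T rowE lt_mark; have /forallP/(_ b)/implyP/(_ bT) := marks.
    by move=> /forallP/(_ b')/implyP/(_ b'T); rewrite same_rowE rowE eqxx lt_mark.
  - move=> b b' bT b'T rowE markE; have /forallP/(_ b)/implyP/(_ bT) := dist.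
    move=> /forallP/(_ b')/implyP/(_ b'T).
    by rewrite same_rowE rowE markE !eqxx => /eqP.
split; last 2 first.
- apply/forallP => b; apply/implyP => bT; apply/forallP => b'; apply/implyP => b'T.
  by rewrite same_rowE; apply/implyP => /andP[/eqP rowE]; exact: marks.
- apply/forallP => b; apply/implyP => bT; apply/forallP => b'; apply/implyP => b'T.
  by rewrite same_rowE; apply/implyP => /andP[/eqP rowE /eqP markE]; apply/eqP/dist.
apply/and3P; split.
- apply/forallP => b; apply/implyP => bT; have [len_gt0 len_dvd] := kbr b bT.
  by rewrite /is_kbrick len_gt0 len_dvd (leq_trans (tend b bT) (row_length_le _)).
- apply/forallP => b; apply/implyP => bT; apply/forallP => b'; apply/implyP => b'T.
  apply/implyP => /eqP neq_b; apply/pred0Pn => -[[x j]] /=.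
  rewrite !in_bcells => /andP[/andP[/eqP bx /andP[jb1 jb2]]].
  move=> /andP[/eqP bx' /andP[jb1' jb2']].
  have [lt|lt|/val_inj eq_mark] := ltngtP (bmark b) (bmark b').
  + by have := marks b b' bT b'T (etrans bx (esym bx')) lt; lia.
  + by have := marks b' b b'T bT (etrans bx' (esym bx)) lt; lia.
  + by case: neq_b; apply: dist => //; rewrite bx.
- apply/eqP/setP => -[x j]; rewrite in_diagram; apply/bigcupP/idP => [[b bT]|].
    rewrite in_bcells => /andP[/eqP <- /andP[_ jb]].
    exact: leq_trans jb (tend b bT).
  by move=> /cov[b bT [bx jb]]; exists b; rewrite // in_bcells bx eqxx.
Qed.

(** Two different bricks of a row have different markings, and the order of the markings then
    separates them. *)
Lemma tab_disjoint T b b' j : dyadic_tabloid T -> b \in T -> b' \in T ->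
  brick_row b = brick_row b' -> bstart b <= j < brick_end b ->
  bstart b' <= j < brick_end b' -> b = b'.
Proof.
move=> tabT bT b'T rowE jb jb'.
have [lt|lt|/val_inj eq_mark] := ltngtP (bmark b) (bmark b').
- by have := tab_marks tabT bT b'T rowE lt; lia.
- by have := tab_marks tabT b'T bT (esym rowE) lt; lia.
- exact: (tab_distinct tabT).
Qed.

(* Each column before c lies in exactly one of the summed bricks. *)
Lemma tab_prefix T x (q c : nat) : dyadic_tabloid T -> c <= row_length x ->
  (forall b, b \in T -> brick_row b = x -> bmark b < q -> brick_end b <= c) ->
  (forall b, b \in T -> brick_row b = x -> q <= bmark b -> c <= bstart b) ->
  c = \sum_(b in T | (brick_row b == x) && (bmark b < q)) blen b.
Proof.
move=> tabT c_le before after.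
have c_n : c <= n := leq_trans c_le (row_length_le x).
have card_interval a e : e <= n -> \sum_(j < n) (a <= j < e) = e - a.
  move=> e_n; rewrite -(big_mkord xpredT (fun j => (a <= j < e) : nat)).
  rewrite (big_cat_nat (leq0n e) e_n) //= [X in _ + X]big_nat_cond [X in _ + X]big1 ?addn0.
    have [ae|ea] := leqP a e.
      rewrite (big_cat_nat (leq0n a) ae) //= big_nat_cond big1 => [|j]; last by lia.
      rewrite add0n big_nat (eq_bigr (fun=> 1)) => [|j ->] //.
      by rewrite -big_nat sum_nat_const_nat muln1.
    rewrite big_nat_cond big1 => [|j]; last by lia.
    by lia.
  by move=> j; lia.
rewrite -[LHS]subn0 -card_interval //.
transitivity (\sum_(j < n) \sum_(b in T | (brick_row b == x) && (bmark b < q))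
   (bstart b <= j < brick_end b)).
  apply: eq_bigr => j _; rewrite leq0n /=; have [jc|cj] := ltnP j c.
    have [b bT [bx jb]] := tab_cover tabT (leq_trans jc c_le).
    rewrite (bigD1 b) /=; last first.
      rewrite bT bx eqxx /= ltnNge; apply/negP => /(after b bT bx); lia.
    rewrite jb big1 // => b' /andP[/andP[b'T /andP[/eqP b'x _]] neq].
    apply/eqP; rewrite eqb0; apply: contraNN neq => jb'; apply/eqP.
    by apply: (tab_disjoint tabT b'T bT _ jb' jb); rewrite bx.
  rewrite big1 // => b /andP[bT /andP[/eqP bx bq]].
  by have := before b bT bx bq; lia.
rewrite exchange_big; apply: eq_bigr => b /andP[bT _].
rewrite card_interval ?addKn //.
exact: leq_trans (tab_end tabT bT) (row_length_le _).
Qed.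

End Tabloids.

(** * Bijection between tabloids and tables of brick lengths *)

Section Lengths.
Variables (n : nat) (s : typ n).
Implicit Types (T : {set brick n}) (b : brick n) (x : 'I_n * 'I_n) (k : 'I_n).
Implicit Type L : {ffun 'I_n * 'I_n -> {ffun 'I_n -> 'I_n.+1}}.
Local Open Scope nat_scope.

Definition dyadic_length_table L : bool :=
  [forall x, dyadic_lengths (row_length s x) (L x)].

(** The column where the brick marked q starts when bricks are laid without gaps by increasing
    marking. Allowing q = n gives the full row. *)
Definition length_prefix L x (q : nat) : nat := \sum_(k < n | k < q) L x k.

(* The start of the brick is only meaningful when [L x k > 0]; [insubd] gives a
   junk value otherwise. *)
Definition laid_brick L x k : brick n :=
  Brick x.1 x.2 (insubd k (length_prefix L x k)) (L x k) k.

Lemma laid_row L x k : brick_row (laid_brick L x k) = x.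
Proof. by case: x. Qed.

Definition tabloid_of L : {set brick n} :=
  [set laid_brick L p.1 p.2 | p in [set p | 0 < L p.1 p.2]].

(** For a distinct tabloid the sum has at most one term. The sum and [inord] make the map total on
    all sets of bricks, as the later reindexing requires. *)
Definition lengths_of T : {ffun 'I_n * 'I_n -> {ffun 'I_n -> 'I_n.+1}} :=
  [ffun x => [ffun k => inord
     (\sum_(b in T | (brick_row b == x) && (bmark b == k)) blen b)]].

Lemma length_prefixS L x k :
  length_prefix L x k.+1 = length_prefix L x k + L x k.
Proof.
rewrite /length_prefix (bigD1 k) //= addnC; congr (_ + _).
by apply: eq_bigl => j; rewrite ltnS -val_eqE /= andbC -ltn_neqAle.
Qed.

Lemma length_prefix_leq L x p q :
  p <= q -> length_prefix L x p <= length_prefix L x q.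
Proof.
move=> pq; rewrite /length_prefix [leqRHS](bigID (fun k : 'I_n => k < p)) /=.
rewrite (eq_bigl (fun k : 'I_n => (k < q) && (k < p))) ?leq_addr // => k.
by rewrite andb_idl // => /leq_trans; apply.
Qed.

Lemma length_prefix_full L x :
  dyadic_length_table L -> length_prefix L x n = row_length s x.
Proof.
move=> /forallP/(_ x)/andP[_ /eqP <-].
by apply: eq_bigl => k; rewrite ltn_ord.
Qed.

Lemma laid_end_le L x k : dyadic_length_table L ->
  length_prefix L x k.+1 <= row_length s x.
Proof. by move=> okL; rewrite -(length_prefix_full x okL) length_prefix_leq. Qed.

Lemma laid_bstart L x k : dyadic_length_table L -> 0 < L x k ->
  bstart (laid_brick L x k) = length_prefix L x k :> nat.
Proof.
move=> okL L_gt0; rewrite val_insubd ifT //.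
have := laid_end_le x k okL; have := row_length_le s x.
by rewrite length_prefixS; lia.
Qed.

Lemma laid_end L x k : dyadic_length_table L -> 0 < L x k ->
  brick_end (laid_brick L x k) = length_prefix L x k.+1.
Proof. by move=> okL L_gt0; rewrite length_prefixS /brick_end laid_bstart. Qed.

Lemma mem_tabloid_of L b : reflect
  (0 < blen b /\ b = laid_brick L (brick_row b) (bmark b)) (b \in tabloid_of L).
Proof.
apply: (iffP imsetP) => [[[[i r] k]]|[len_gt0 bE]].
  by rewrite inE => L_gt0 ->.
exists (brick_row b, bmark b) => //; rewrite inE.
by move: len_gt0; rewrite bE.
Qed.

Lemma laid_in L x k : 0 < L x k -> laid_brick L x k \in tabloid_of L.
Proof. by move=> L_gt0; apply/mem_tabloid_of; rewrite laid_row. Qed.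

Lemma tabloid_ofP L : dyadic_length_table L -> dyadic_tabloid s (tabloid_of L).
Proof.
move=> okL; have laid b : b \in tabloid_of L ->
    [/\ 0 < L (brick_row b) (bmark b), blen b = L (brick_row b) (bmark b) :> nat,
        bstart b = length_prefix L (brick_row b) (bmark b) :> nat
      & brick_end b = length_prefix L (brick_row b) (bmark b).+1].
  move=> /mem_tabloid_of[len_gt0 bE].
  have L_gt0 : 0 < L (brick_row b) (bmark b) by move: len_gt0; rewrite bE.
  by split; rewrite // {1}bE ?laid_bstart ?laid_end.
split.
- move=> b /laid[L_gt0 -> _ _]; split=> //.
  by have /forallP/(_ (brick_row b))/andP[/forallP] := okL; exact.
- by move=> b /laid[_ _ _ ->]; exact: laid_end_le.
- move=> x j; rewrite -(length_prefix_full x okL) => j_lt.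
  (* Column j is covered by the brick whose marking precedes the least q with j below the prefix at
     q; q = 0 is excluded since that prefix is empty. *)
  have ex_q : exists q, j < length_prefix L x q by exists n.
  case: (ex_minnP ex_q) => [[|q]] j_q q_min.
    by move: j_q; rewrite /length_prefix big_pred0.
  have q_n : q < n by exact: q_min.
  have q_j : length_prefix L x q <= j.
    by rewrite leqNgt; apply/negP => /q_min; rewrite ltnn.
  pose k := Ordinal q_n.
  have L_gt0 : 0 < L x k.
    by have := leq_ltn_trans q_j j_q; rewrite (length_prefixS L x k) /=; lia.
  exists (laid_brick L x k); first exact: laid_in.
  by rewrite laid_row laid_bstart // laid_end // q_j.
- move=> b b' /laid[_ _ _ ->] /laid[_ _ -> _] -> lt_mark.
  exact: length_prefix_leq.
- move=> b b' /mem_tabloid_of[_ bE] /mem_tabloid_of[_ b'E] rowE markE.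
  by rewrite bE b'E rowE markE.
Qed.

Lemma lengths_of_mem T b : dyadic_tabloid s T -> b \in T ->
  lengths_of T (brick_row b) (bmark b) = blen b.
Proof.
move=> tabT bT; apply: val_inj; rewrite /= !ffunE.
rewrite (big_pred1 b) ?inordK // => b' /=.
apply/andP/eqP => [[b'T /andP[/eqP rowE /eqP markE]]|->]; last by rewrite bT !eqxx.
exact: (tab_distinct tabT).
Qed.

Lemma lengths_ofE T x k : dyadic_tabloid s T ->
  lengths_of T x k =
    \sum_(b in T | (brick_row b == x) && (bmark b == k)) blen b :> nat.
Proof.
move=> tabT; have [b /andP[bT /andP[/eqP <- /eqP <-]]|none] :=
  pickP [pred b | (b \in T) && ((brick_row b == x) && (bmark b == k))].
  rewrite lengths_of_mem // (big_pred1 b) // => b' /=.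
  apply/andP/eqP => [[b'T /andP[/eqP rowE /eqP markE]]|->]; last by rewrite bT !eqxx.
  exact: (tab_distinct tabT).
by rewrite !ffunE big_pred0 // inordK.
Qed.

Lemma length_prefix_of T x q : dyadic_tabloid s T ->
  length_prefix (lengths_of T) x q =
    \sum_(b in T | (brick_row b == x) && (bmark b < q)) blen b.
Proof.
move=> tabT; rewrite /length_prefix.
rewrite [RHS](partition_big (@bmark n) (fun k => k < q)) => [|b /and3P[] //].
apply: eq_bigr => k kq; rewrite lengths_ofE //; apply: eq_bigl => b.
by rewrite -!andbA; case: (eqVneq (bmark b) k) => [->|]; rewrite ?kq ?andbF.
Qed.

Lemma lengths_of_ok T : dyadic_tabloid s T -> dyadic_length_table (lengths_of T).
Proof.
move=> tabT; apply/forallP => x; apply/andP; split.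
  apply/forallP => k; rewrite lengths_ofE //.
  have [b /andP[bT /andP[/eqP bx /eqP bk]]|none] :=
    pickP [pred b | (b \in T) && ((brick_row b == x) && (bmark b == k))].
    rewrite -lengths_ofE // -bx -bk lengths_of_mem //.
    by have [] := tab_kbrick tabT bT.
  by rewrite big_pred0 // dvdn0.
have -> : \sum_k lengths_of T x k = length_prefix (lengths_of T) x n.
  by apply: eq_bigl => k; rewrite ltn_ord.
(* Cutting the row at its very end, with q = n, counts all its bricks. *)
rewrite length_prefix_of // -(@tab_prefix _ s T x n (row_length s x)) // => b bT.
  by move=> <- _; exact: (tab_end tabT).
by move=> _; rewrite leqNgt ltn_ord.
Qed.

(** The row is cut where b starts: bricks of smaller marking end before this column, b and those of
    larger marking start at or after it. *)
Lemma tab_bstart T b : dyadic_tabloid s T -> b \in T ->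
  bstart b = length_prefix (lengths_of T) (brick_row b) (bmark b) :> nat.
Proof.
move=> tabT bT; rewrite length_prefix_of //; apply: (tab_prefix (s := s)) => //.
- exact: leq_trans (leq_addr _ _) (tab_end tabT bT).
- by move=> b' b'T rowE lt_mark; exact: (tab_marks tabT).
move=> b' b'T rowE; rewrite leq_eqVlt => /predU1P[/val_inj eq_mark|lt_mark].
  by rewrite (tab_distinct tabT b'T bT).
by apply: leq_trans (leq_addr _ _) (tab_marks tabT bT b'T (esym rowE) lt_mark).
Qed.

Lemma lengths_ofK T : dyadic_tabloid s T -> tabloid_of (lengths_of T) = T.
Proof.
move=> tabT; have bE b : b \in T ->
    b = laid_brick (lengths_of T) (brick_row b) (bmark b).
  move=> bT; rewrite /laid_brick lengths_of_mem // -tab_bstart // valKd.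
  by case: b bT.
apply/setP => b; apply/mem_tabloid_of/idP => [[len_gt0 b_laid]|bT]; last first.
  by split; [have [] := tab_kbrick tabT bT | exact: bE].
have : 0 < lengths_of T (brick_row b) (bmark b) by move: len_gt0; rewrite b_laid.
rewrite lengths_ofE //.
have [b' /andP[b'T /andP[/eqP rowE /eqP markE]]|none] := pickP
  [pred b' | (b' \in T) && ((brick_row b' == brick_row b) && (bmark b' == bmark b))].
  by rewrite b_laid -rowE -markE -bE.
by rewrite big_pred0.
Qed.

Lemma tabloid_ofK L : dyadic_length_table L -> lengths_of (tabloid_of L) = L.
Proof.
move=> okL; have tabL := tabloid_ofP okL.
apply/ffunP => x; apply/ffunP => k; apply: val_inj => /=.
have [L0|L_gt0] := posnP (L x k); last first.
  by have := lengths_of_mem tabL (laid_in L_gt0); rewrite laid_row => ->.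
rewrite lengths_ofE // L0 big_pred0 // => b; apply/negP.
move=> /andP[/mem_tabloid_of[len_gt0 bE] /andP[/eqP bx /eqP bk]].
by move: len_gt0; rewrite bE bx bk /= L0.
Qed.

End Lengths.

(** * Expansion of H_sigma over tabloids *)

Lemma H_deg0 : H 0 = 1.
Proof.
apply/funext => m; rewrite /H [RHS]/GRing.one /= /ps_one; congr (nat_of_bool _)%:R.
apply/eqP/eqP => [m0|->]; last by rewrite /deg mdom1 big_seq_fset0.
apply/eqP/cmP => v; rewrite cm1; have := leq_deg m v.
by rewrite m0 leqn0 muln_eq0 => /orP[//|/eqP].
Qed.

Lemma Eplus_deg0 : Eplus 0 = 1.
Proof.
rewrite -H_deg0; apply/funext => m; rewrite /Eplus /H; congr (nat_of_bool _)%:R.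
apply: andb_idr => /eqP m0; apply/squarefreeP => v; have := leq_deg m v.
by rewrite m0 leqn0 muln_eq0 => /orP[//|/eqP ->].
Qed.

(** Each partition is padded to n rows by rows of length 0, which contribute the neutral element;
    rows are then indexed uniformly by pairs. *)
Lemma big_rows (R : Type) (idx : R) (op : Monoid.com_law idx) n (s : typ n)
    (i : 'I_n) (F : nat -> R) : F 0%N = idx ->
  \big[op/idx]_(d <- s i) F d = \big[op/idx]_(r < n) F (row_length s (i, r)).
Proof.
move=> F0; rewrite (big_nth 0%N) big_mkord.
rewrite (big_ord_widen n (fun r => F (nth 0%N (s i) r))) ?size_type_le //.
rewrite big_mkcond /=; apply: eq_bigr => r _; rewrite /row_length /=.
by case: ltnP => // r_out; rewrite nth_default.
Qed.

(** Each row is expanded by [H_dyadic]. Distributing the product over the rows chooses one length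
    sequence per row, which amounts to a tabloid. *)
Lemma H_expansion n (s : typ n) :
  type_prod H s = \sum_(T : {set brick n} | is_dyadic_tabloid s T)
    \prod_(c <- content T) ps_pow_subst c.2 (Eplus c.1).
Proof.
pose F (x : 'I_n * 'I_n) (k l : nat) :=
  ps_pow_subst (2 ^ k * x.1.+1) (Eplus (l %/ 2 ^ k)).
have F0 x k : F x k 0%N = 1.
  by rewrite /F div0n Eplus_deg0 ps_pow_subst1 // muln_gt0 expn_gt0.
transitivity (\prod_(x : 'I_n * 'I_n)
    \sum_(l : {ffun 'I_n -> 'I_n.+1} | dyadic_lengths (row_length s x) l)
       \prod_(k < n) F x k (l k)).
  rewrite type_prodE big_blocks /=.
  under eq_bigr => i _.
    rewrite (@big_rows _ _ _ n s i (fun d => ps_pow_subst i.+1 (H d))); last first.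
      by rewrite H_deg0 ps_pow_subst1.
    over.
  rewrite pair_bigA /=; apply: eq_bigr => -[i r] _.
  rewrite (H_dyadic (row_length_le _ _)) ps_pow_subst_sum //.
  apply: eq_bigr => l _; rewrite ps_pow_subst_prod //.
  by apply: eq_bigr => k _; rewrite ps_pow_subst_comp ?expn_gt0.
rewrite bigA_distr_big_dep /=.
(* The side condition that T is rebuilt from its lengths, together with the validity of these
   lengths, singles out the tabloids. *)
rewrite (reindex_onto (@lengths_of n) (@tabloid_of n)) /=; last first.
  by move=> L /familyP okL; apply: tabloid_ofK; apply/forallP => x; exact: okL.
apply: eq_big => [T|T].
  apply/andP/dyadic_tabloidP => [[/familyP okL /eqP <-]|tabT].
    by apply: tabloid_ofP; apply/forallP => x; exact: okL.
  split; last by rewrite (lengths_ofK tabT).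
  by have /forallP okL := lengths_of_ok tabT; apply/familyP => x; exact: okL.
move=> /andP[_ /eqP TE].
rewrite big_map big_enum -[in RHS]TE /=.
(* Bricks are indexed by row and marking; the pairs of length 0, which give no brick, contribute the
   factor 1 by [F0]. *)
rewrite [in RHS]big_imset /=; last by move=> [[i r] k] [[i' r'] k'] _ _ [-> -> _ _ ->].
rewrite pair_bigA /= big_mkcond [RHS]big_mkcond /=; apply: eq_bigr => -[x k] _.
rewrite inE /=; case: posnP => [-> |_]; by rewrite ?F0.
Qed.

Lemma type_prod_perm n (t : typ n) bs (F : nat -> pseries) :
  perm_eq bs (blocks t) ->
  type_prod F t = \prod_(b <- bs) ps_pow_subst b.2 (F b.1).
Proof. by move=> bs_t; rewrite type_prodE (perm_big _ bs_t). Qed.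

(** A brick of length l in tensor factor m gives a block of weight l m, whatever its marking.
    Summing over the rows yields the weight of [s], which is n. *)
Lemma content_type n (s : typ n) (T : {set brick n}) : dyadic_tabloid s T ->
  exists t : typ n, perm_eq (blocks t) (content T).
Proof.
move=> tabT; apply: blocks_ex.
  apply/allP => _ /mapP[b b_in ->] /=; rewrite mem_enum in b_in.
  have [len_gt0 len_dvd] := tab_kbrick tabT b_in.
  by rewrite muln_gt0 expn_gt0 divn_gt0 ?expn_gt0 // dvdn_leq.
rewrite big_map big_enum /=.
transitivity (\sum_(b in T) blen b * (bfactor b).+1)%N.
  apply: eq_bigr => b bT; have [_ len_dvd] := tab_kbrick tabT bT.
  by rewrite mulnA divnK.
rewrite (partition_big (@brick_row n) xpredT) //=.
rewrite -[RHS](eqP (valP s)) -(pair_big_dep xpredT (fun _ _ => true)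
  (fun i r => \sum_(b in T | brick_row b == (i, r)) blen b * (bfactor b).+1)%N) /=.
apply: eq_bigr => i _.
rewrite sumnE (@big_rows _ _ _ n s i id) // big_distrr; apply: eq_bigr => r _ /=.
rewrite -(length_prefix_full (i, r) (lengths_of_ok tabT)) (length_prefix_of _ _ tabT).
rewrite big_distrr; apply: eq_big => [b|b /andP[_ /eqP[-> _]]]; last exact: mulnC.
by rewrite ltn_ord andbT.
Qed.

Lemma Eplus_expansion_H n (s : typ n) :
  Eplus_expansion (type_prod H s) [ffun t : typ n => #|PTdyad_dis s t|%:R].
Proof.
move=> m; rewrite H_expansion ps_coef_sum.
(* The content of a tabloid is the block list of exactly one type, so the inner sum has one term;
   exchanging the sums groups tabloids by content. *)
transitivity (\sum_(T : {set brick n} | is_dyadic_tabloid s T)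
  \sum_(t : typ n | perm_eq (content T) (blocks t)) type_prod Eplus t m).
  apply: eq_bigr => T /dyadic_tabloidP/content_type[t t_T].
  rewrite (big_pred1 t) => [|t' /=].
    by rewrite (@type_prod_perm _ t (content T)) 1?perm_sym.
  apply/idP/eqP => [T_t'|->]; last by rewrite perm_sym.
  by apply: blocks_inj; rewrite perm_sym (perm_trans t_T T_t').
rewrite (exchange_big_dep xpredT) //=; apply: eq_bigr => t _.
rewrite ffunE sumr_const mulr_natl; congr (_ *+ _); apply: eq_card => T.
rewrite !inE /is_tabloid /is_dyadic_tabloid unfold_in /=.
by rewrite -!andbA; do !bool_congr; rewrite andbC.
Qed.

(** * Linear independence of the E+_tau *)

(* The blocks (d' i, r' i) arise from the blocks (d j, r j) by splitting and
   merging: [G i j] is the number of times the block j is merged into the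
   block i. *)
Section Refinement.
Variables (p q n : nat) (d r : 'I_p -> nat) (d' r' : 'I_q -> nat).
Variable (G : 'I_q -> 'I_p -> nat).
Local Open Scope nat_scope.

Hypothesis d_gt0 : forall j, 0 < d j.
Hypothesis r_gt0 : forall j, 0 < r j.
Hypothesis d'_gt0 : forall i, 0 < d' i.
Hypothesis r'_gt0 : forall i, 0 < r' i.
Hypothesis weight_d : \sum_j d j * r j = n.
Hypothesis d'E : forall i, d' i = \sum_j d j * G i j.
Hypothesis rE : forall j, r j = \sum_i r' i * G i j.
Hypothesis energy_le : n.+1 * (\sum_i r' i * d' i ^ 2) + q <=
                       n.+1 * (\sum_j r j * d j ^ 2) + p.

Let le_d' i j : 0 < G i j -> d j <= d' i.
Proof.
move=> G_gt0; rewrite d'E (bigD1 j) //=.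
by apply: leq_trans (leq_addr _ _); rewrite leq_pmulr.
Qed.

(* [d j <= d' i] as soon as [G i j > 0], so (sum_j G d)^2 >= sum_j (G d) d. *)
Let sum_squares i :
  \sum_j G i j * d j ^ 2 <= d' i ^ 2 ?= iff
  [forall j, G i j * d j ^ 2 == G i j * d j * d' i].
Proof.
have -> : d' i ^ 2 = \sum_j G i j * d j * d' i.
  by rewrite -big_distrl -mulnn {1}d'E; congr (_ * _); apply: eq_bigr => j _; exact: mulnC.
apply: leqif_sum => j _; split=> //.
case: (posnP (G i j)) => [->|/le_d' le_dd] //.
by rewrite -mulnn mulnA leq_mul2l le_dd orbT.
Qed.

Let energyE : \sum_j r j * d j ^ 2 = \sum_i r' i * \sum_j G i j * d j ^ 2.
Proof.
transitivity (\sum_j \sum_i r' i * (G i j * d j ^ 2)).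
  by apply: eq_bigr => j _; rewrite rE big_distrl; apply: eq_bigr => i _; rewrite /= mulnA.
by rewrite exchange_big; apply: eq_bigr => i _; rewrite big_distrr.
Qed.

Let energy_leqif : \sum_j r j * d j ^ 2 <= \sum_i r' i * d' i ^ 2 ?= iff
  [forall i, [forall j, G i j * d j ^ 2 == G i j * d j * d' i]].
Proof.
rewrite energyE; apply: leqif_sum => i _.
have [le_i eq_i] := sum_squares i.
by split; rewrite ?leq_mul2l ?le_i ?orbT // eqn_pmul2l.
Qed.

(** Merging cannot decrease the sum of squares, and since p <= n the factor n+1 prevents the block
    counts from compensating an increase. *)
Let energy_eq : \sum_j r j * d j ^ 2 = \sum_i r' i * d' i ^ 2.
Proof.
have p_le_n : p <= n.
  rewrite -weight_d -[leqLHS]card_ord -sum1_card; apply: leq_sum => j _.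
  by rewrite muln_gt0 d_gt0 r_gt0.
by have [le_e _] := energy_leqif; nia.
Qed.

(** Equality of the sums of squares forces every block merged into i to have the full degree [d' i],
    which leaves room for only one. *)
Let single i : exists j, forall k, G i k = (k == j).
Proof.
have /forallP/(_ i)/forallP all_eq :
    [forall i, [forall j, G i j * d j ^ 2 == G i j * d j * d' i]].
  by rewrite -(snd energy_leqif) energy_eq.
have d_eq k : 0 < G i k -> d k = d' i.
  move=> G_gt0; have := all_eq k.
  by rewrite -mulnn mulnA eqn_pmul2l ?muln_gt0 ?G_gt0 ?d_gt0 // => /eqP.
have [j G_gt0] : exists j, 0 < G i j.
  apply/existsP; apply: contraT; rewrite negb_exists => /forallP G0.
  have := d'_gt0 i; rewrite d'E big1 // => k _.
  by move: (G0 k); rewrite -eqn0Ngt => /eqP ->; rewrite muln0.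
exists j => k; have := d'E i; rewrite (bigD1 j) //= -(d_eq j) //.
have [->|neq] := eqVneq k j; first by have := d_gt0 j; nia.
rewrite (bigD1 k) //=; have := d_gt0 j; have := d_gt0 k; nia.
Qed.

(** Without merging, each new block i is a piece of one old block [phi i]. Every old block has a
    piece, and the energy bound gives q <= p, so [phi] is a bijection and nothing is split. *)
Lemma refinement_perm :
  perm_eq [seq (d' i, r' i) | i : 'I_q] [seq (d j, r j) | j : 'I_p].
Proof.
have [phi GE] := fin_all_exists single.
have rE' j : r j = \sum_(i | phi i == j) r' i.
  rewrite rE [RHS]big_mkcond; apply: eq_bigr => i _; rewrite GE eq_sym.
  by case: eqP; rewrite ?muln1 ?muln0.
have /fin_all_exists[psi phi_psi] : forall j, exists i, phi i = j.
  move=> j; apply/exists_eqP; apply: contraT.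
  rewrite negb_exists => /forallP no_i; have := r_gt0 j.
  by rewrite rE' big_pred0 // => i; apply/negbTE.
have psi_inj : injective psi := can_inj phi_psi.
have qp : q = p.
  apply/eqP; rewrite eqn_leq.
  have := leq_card _ psi_inj; rewrite !card_ord => ->; rewrite andbT.
  by move: energy_le; rewrite energy_eq leq_add2l.
have psi_bij : bijective psi.
  by apply: inj_card_bij => //; rewrite !card_ord qp.
have psi_phi : cancel phi psi.
  by move=> i; apply: (bij_inj (bij_can_bij psi_bij phi_psi)); rewrite phi_psi.
rewrite perm_sym.
have -> : [seq (d j, r j) | j : 'I_p] =
    [seq (d' i, r' i) | i <- [seq psi j | j : 'I_p]].
  rewrite -map_comp; apply: eq_map => j /=; congr (_, _).
    rewrite d'E (bigD1 j) //= GE phi_psi eqxx muln1 big1 ?addn0 // => k kj.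
    by rewrite GE phi_psi (negPf kj) muln0.
  rewrite rE' (big_pred1 (psi j)) // => i /=.
  by rewrite -(can_eq psi_phi) phi_psi -(inj_eq psi_inj) psi_phi.
apply: perm_map; apply: uniq_perm => [||i]; rewrite ?map_inj_uniq -?enumT ?enum_uniq //.
by rewrite mem_enum -[in LHS](psi_phi i) image_f.
Qed.

End Refinement.

(** * Positivity and support of products of series *)

Definition ps_nonneg (f : pseries) : Prop := forall m, 0 <= f m.

Lemma ps_mul_nonneg (f g : pseries) :
  ps_nonneg f -> ps_nonneg g -> ps_nonneg (f * g).
Proof.
move=> f_ge0 g_ge0 m; rewrite /GRing.mul /= (@ps_mul_divisors (divisors_of m)) ?undup_uniq //.
by do 2![apply: sumr_ge0 => ? _]; rewrite !mulr_ge0.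
Qed.

Lemma ps_mul_gt0 (f g : pseries) a b : ps_nonneg f -> ps_nonneg g ->
  0 < f a -> 0 < g b -> 0 < (f * g) (mmul a b).
Proof.
move=> f_ge0 g_ge0 fa gb; have [a_m b_m] := mmul_divisors (erefl (mmul a b)).
rewrite /GRing.mul /= (@ps_mul_divisors (divisors_of (mmul a b))) ?undup_uniq //.
rewrite (bigD1_seq a) ?undup_uniq //= (bigD1_seq b) ?undup_uniq //= eqxx mul1r.
rewrite -addrA ltr_wpDr ?mulr_gt0 // addr_ge0 ?sumr_ge0 // => *.
  by rewrite !mulr_ge0.
by apply: sumr_ge0 => *; rewrite !mulr_ge0.
Qed.

Lemma ps_mul_neq0 (f g : pseries) m : (f * g) m != 0 ->
  exists a b, [/\ mmul a b = m, f a != 0 & g b != 0].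
Proof.
apply: contra_neqP => no_ab; apply: fsbig1 => -[a b] /= abm.
apply/eqP; apply: contra_notT no_ab; rewrite mulf_eq0 negb_or => /andP[fa gb].
by exists a, b.
Qed.

Lemma ps_prod_gt0 (I : Type) (r : seq I) (F : I -> pseries) (h : I -> monom) :
  (forall i, ps_nonneg (F i)) -> (forall i, 0 < F i (h i)) ->
  0 < (\prod_(i <- r) F i) (\big[mmul/mone]_(i <- r) h i).
Proof.
move=> F_ge0 Fh; suff [] : ps_nonneg (\prod_(i <- r) F i) /\
  0 < (\prod_(i <- r) F i) (\big[mmul/mone]_(i <- r) h i) by [].
elim: r => [|i r [IHge0 IHgt0]].
  by rewrite !big_nil /GRing.one /= /ps_one eqxx; split=> // m; exact: ler0n.
by rewrite !big_cons; split; [exact: ps_mul_nonneg | exact: ps_mul_gt0].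
Qed.

(** The indices are distinct because [h] selects one monomial per index, whereas two occurrences of
    an index could call for different monomials. *)
Lemma ps_prod_neq0 (I : eqType) (r : seq I) (F : I -> pseries) m :
  uniq r -> (\prod_(i <- r) F i) m != 0 ->
  exists h : I -> monom, m = \big[mmul/mone]_(i <- r) h i /\
    forall i, i \in r -> F i (h i) != 0.
Proof.
elim: r m => [|i r IHr] m /=.
  rewrite !big_nil /GRing.one /= /ps_one => _ m1; exists (fun=> mone).
  by rewrite big_nil; split=> //; apply/eqP; move: m1; case: (m == mone).
move=> /andP[i_r r_uniq]; rewrite big_cons => /ps_mul_neq0[a [b [<- Fa Fb]]].
have [h [-> Fh]] := IHr b r_uniq Fb.
exists (fun j => if j == i then a else h j); split.
  rewrite big_cons eqxx; congr mmul; apply: eq_big_seq => j jr.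
  by case: eqP => // ji; rewrite -ji jr in i_r.
move=> j; rewrite inE; case: eqP => [-> //|_ /=]; exact: Fh.
Qed.

Lemma prod_monomE (I : Type) (r : seq I) (h : I -> monom) v :
  (\big[mmul/mone]_(i <- r) h i) v = (\sum_(i <- r) h i v)%N.
Proof.
by apply: (big_morph (fun m : monom => m v)) => [a b|]; rewrite ?cmM ?cm1.
Qed.

(** * Leading monomials of the E+_tau *)

Section LeadingMonomial.
Variable n : nat.
Implicit Types (t u : typ n).

Definition block_deg t (j : 'I_(size (blocks t))) : nat :=
  (nth (0, 0)%N (blocks t) j).1.
Definition block_mult t (j : 'I_(size (blocks t))) : nat :=
  (nth (0, 0)%N (blocks t) j).2.

Lemma block_deg_gt0 t (j : 'I_(size (blocks t))) : (0 < block_deg j)%N.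
Proof. by have /blocks_gt0/andP[] := mem_nth (0, 0)%N (ltn_ord j). Qed.

Lemma block_mult_gt0 t (j : 'I_(size (blocks t))) : (0 < block_mult j)%N.
Proof. by have /blocks_gt0/andP[] := mem_nth (0, 0)%N (ltn_ord j). Qed.

Lemma big_blocks_ord (R : Type) (idx : R) (op : Monoid.com_law idx) t
    (F : nat -> nat -> R) :
  \big[op/idx]_(b <- blocks t) F b.1 b.2 =
  \big[op/idx]_(j < size (blocks t)) F (block_deg j) (block_mult j).
Proof. by rewrite (big_nth (0, 0)%N) big_mkord. Qed.

(** The position j as second index keeps the variables of equal blocks apart; the predecessor
    reflects that indices start at 0. *)
Definition block_var t (j : 'I_(size (blocks t))) : nat * nat :=
  ((block_deg j).-1, val j).

Definition leading_monom t : monom :=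
  \big[mmul/mone]_(j < size (blocks t)) expcmn (ucm (block_var j)) (block_mult j).

(* As a type of n has at most n blocks, this orders types lexicographically by
   sum r d^2, then by the number of blocks. *)
Definition energy t : nat :=
  (n.+1 * (\sum_(b <- blocks t) b.2 * b.1 ^ 2) + size (blocks t))%N.

Lemma block_var_inj t : injective (@block_var t).
Proof. by move=> i j /(congr1 snd)/val_inj. Qed.

Lemma leading_monom_var t (j : 'I_(size (blocks t))) :
  leading_monom t (block_var j) = block_mult j.
Proof.
rewrite prod_monomE (bigD1 j) //= expcmnE cmUU muln1 big1 ?addn0 // => k kj.
by rewrite expcmnE cmU (inj_eq (@block_var_inj t)) (negPf kj) muln0.
Qed.

Lemma leading_monom_supp t v :
  (0 < leading_monom t v)%N -> exists j, v = block_var (t := t) j.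
Proof.
rewrite prod_monomE lt0n sum_nat_eq0 negb_forall => /existsP[j].
by rewrite expcmnE cmU; have [<-|] := eqVneq (block_var j) v; [exists j | rewrite muln0].
Qed.

Lemma Eplus_leading_gt0 t : 0 < type_prod Eplus t (leading_monom t).
Proof.
rewrite type_prodE (big_blocks_ord _ _ (fun d r => ps_pow_subst r (Eplus d))).
apply: ps_prod_gt0 => j.
  move=> m; have [[a ->]|no_root] := pselect (exists a, m = expcmn a (block_mult j)).
    by rewrite ps_pow_subst_expcmn ?block_mult_gt0 // ler0n.
  by rewrite [leRHS]fsbig1 // => a ma; case: no_root; exists a.
rewrite ps_pow_subst_expcmn ?block_mult_gt0 // /Eplus /deg mdomU big_seq_fset1.
rewrite cmUU muln1 prednK ?block_deg_gt0 // eqxx ltr0n lt0b.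
by apply/squarefreeP => v; rewrite cmU leq_b1.
Qed.

(** A nonzero coefficient yields a factorisation of x^t into powers of monomials g_i, one per block
    of [u]. The exponents of the g_i describe how the blocks of [t] are split and merged into those
    of [u]. *)
Lemma Eplus_leading_neq0 t u : (energy u <= energy t)%N ->
  type_prod Eplus u (leading_monom t) != 0 -> u = t.
Proof.
rewrite type_prodE (big_blocks_ord _ _ (fun d r => ps_pow_subst r (Eplus d))).
move=> le_ut /ps_prod_neq0[|h [leadE h_neq0]]; first exact: index_enum_uniq.
have root j : exists a, h j = expcmn a (block_mult j) /\ deg a = block_deg j.
  have h_j := h_neq0 j (mem_index_enum j).
  have [a aE] := ps_pow_subst_neq0 h_j; exists a; split=> //; move: h_j.
  rewrite aE ps_pow_subst_expcmn ?block_mult_gt0 // /Eplus.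
  by case: (deg a =P block_deg j) => // _; rewrite eqxx.
have [g gP] := fin_all_exists root.
have lead_g v : leading_monom t v = (\sum_i block_mult i * g i v)%N.
  rewrite leadE prod_monomE; apply: eq_bigr => i _.
  by have [-> _] := gP i; rewrite expcmnE.
(* Each g_i involves only block variables of [t], so its degree is a sum over the blocks of [t]. *)
have g_supp i v : (0 < g i v)%N -> exists j, v = block_var (t := t) j.
  move=> g_gt0; apply: leading_monom_supp; rewrite lead_g (bigD1 i) //=.
  by rewrite addn_gt0 muln_gt0 block_mult_gt0 g_gt0.
apply: blocks_inj.
have blocksE w : [seq (block_deg j, block_mult j) | j : 'I_(size (blocks w))] = blocks w.
  rewrite -[RHS](mkseq_nth (0, 0)%N) /mkseq -val_enum_ord -map_comp.
  by apply: eq_map => j; rewrite /= [RHS]surjective_pairing.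
rewrite -(blocksE u) -(blocksE t).
apply: (@refinement_perm _ _ n _ _ _ _ (fun i j => g i (block_var j))).
- exact: block_deg_gt0.
- exact: block_mult_gt0.
- exact: block_deg_gt0.
- exact: block_mult_gt0.
- by rewrite -(big_blocks_ord _ _ muln) weight_blocks.
- move=> i; have [_ <-] := gP i.
  rewrite (@deg_widen _ [fset block_var j | j : 'I_(size (blocks t))]%fset).
    rewrite big_imfset /=; last by move=> j k _ _; exact: block_var_inj.
    by rewrite big_enum; apply: eq_bigr => j _; rewrite /= prednK ?block_deg_gt0.
  apply/fsubsetP => v; rewrite -cmE_neq0 -lt0n => /g_supp[j ->].
  by apply/imfsetP; exists j.
- by move=> j; rewrite -lead_g leading_monom_var.
- move: le_ut; rewrite /energy.
  by rewrite !(big_blocks_ord _ _ (fun d r => r * d ^ 2)%N).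
Qed.

Lemma Eplus_free (c : typ n -> rat) :
  (forall m, \sum_t c t * type_prod Eplus t m = 0) -> forall t, c t = 0.
Proof.
move=> c_rel t1; apply/eqP; apply: contraT => c1.
have [t c_t t_max] := @arg_maxnP _ t1 (fun t => c t != 0) energy c1.
have := c_rel (leading_monom t); rewrite (bigD1 t) //= big1 ?addr0 => [|u ut].
  by move=> /eqP; rewrite mulf_eq0 (negPf c_t) (gt_eqF (Eplus_leading_gt0 t)).
apply/eqP; apply: contraNT ut; rewrite mulf_eq0 negb_or => /andP[c_u E_u].
by apply/eqP/Eplus_leading_neq0 => //; exact: t_max.
Qed.

End LeadingMonomial.

(* There is one and only one family of coefficients expanding H_sigma in the
   Eplus_rho, and its value at tau is the number of tabloids. *)
Theorem theorem53 (n : nat) (sigma tau : typ n) :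
  exists c : {ffun typ n -> rat},
    unique (fun c' : {ffun typ n -> rat} =>
              Eplus_expansion (type_prod H sigma) c') c
    /\ c tau = #|PTdyad_dis sigma tau|%:R.
Proof.
exists [ffun t => #|PTdyad_dis sigma t|%:R]; split; last by rewrite ffunE.
split=> [|c c_exp]; first exact: Eplus_expansion_H.
(* The difference of two expansions is a linear relation between the E+_rho. *)
apply/ffunP => t; apply/eqP; rewrite -subr_eq0; apply/eqP; move: t.
apply: Eplus_free => m; under eq_bigr => t _ do rewrite mulrBl.
by rewrite sumrB -c_exp -Eplus_expansion_H subrr.
Qed.
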